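(* Let $f:\{0,1\}^n\to\{0,1\}$ and let $A=f^{-1}(1)\subseteq\{0,1\}^n$ be its support. Let $E(A)$ denote the additive energy of $A$. Then $$\frac{3|A|^3}{128\,E(A)}< I(f)\,|\mathrm{supp}(\widehat{f})|^2.$$
   Context: $\{0,1\}^n$ is viewed as the vector space $\mathbb{F}_2^n$ and identified with subsets of $[n]=\{1,\dots,n\}$ (a subset $S$ corresponds to the vector with $x_i=1$ iff $i\in S$). The additive energy of $A$ is $E(A)=|\{(a_1,a_2,a_3,a_4)\in A^4: a_1+a_2=a_3+a_4\}|$. The Fourier transform is $\widehat{f}(S)=\frac{1}{2^n}\sum_{x\in\{0,1\}^n} f(x)(-1)^{\langle S,x\rangle_2}$ with $\langle x,y\rangle_2=\sum_i x_iy_i \bmod 2$, and $\mathrm{supp}(\widehat{f})=\{S\subseteq[n]:\widehat{f}(S)\ne 0\}$. The influence of the $i$-th variable is $\mathrm{Inf}_i(f)=\Pr_{x}[f(x)\ne f(x+e_i)]$ with $x$ uniform on $\{0,1\}^n$ and $e_i$ the $i$-th standard basis vector, and the total influence is $I(f)=\sum_{i=1}^n\mathrm{Inf}_i(f)$.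
   Formalization: The function f is assumed non-constant: for f identically 1 the left side is 3/128 while I(f)=0, so the inequality fails, and for f identically 0 the left side is 0/0. *)

(* Defs.v *)
From HB Require Import structures.
From mathcomp Require Import all_boot all_order all_algebra.

Set Implicit Arguments.
Unset Strict Implicit.
Unset Printing Implicit Defensive.

Import Order.TTheory GRing.Theory Num.Theory.
Local Open Scope ring_scope.

Notation cube n := 'rV['F_2]_n.

Definition indicator_vec (n : nat) (S : {set 'I_n}) : cube n :=
  \row_i (i \in S)%:R.

Definition basis_vec (n : nat) (i : 'I_n) : cube n := delta_mx 0 i.

Definition dot2 (n : nat) (x y : cube n) : 'F_2 := \sum_i x 0 i * y 0 i.

Definition bool_support (n : nat) (f : cube n -> bool) : {set cube n} :=
  [set x | f x].

Definition additive_energy (n : nat) (A : {set cube n}) : nat :=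
  #|[set a : cube n * cube n * cube n * cube n |
      let '(a1, a2, a3, a4) := a in
      [&& a1 \in A, a2 \in A, a3 \in A, a4 \in A & a1 + a2 == a3 + a4]]|.

(* The exponent is the representative in {0, 1} of an element of 'F_2. *)
Definition fourier (R : realFieldType) (n : nat) (g : cube n -> R)
    (S : {set 'I_n}) : R :=
  (2 ^+ n)^-1 *
  \sum_(x : cube n) g x * (-1) ^+ nat_of_ord (dot2 (indicator_vec S) x).

Definition fourier_support (R : realFieldType) (n : nat) (g : cube n -> R) :
    {set {set 'I_n}} :=
  [set S | fourier g S != 0].

Definition influence (R : realFieldType) (n : nat) (f : cube n -> bool)
    (i : 'I_n) : R :=
  #|[set x : cube n | f x != f (x + basis_vec i)]|%:R / #|{: cube n}|%:R.

Definition total_influence (R : realFieldType) (n : nat) (f : cube n -> bool) :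
    R :=
  \sum_(i < n) influence R f i.

(* Main.v *)
(** Let [a = |A|], [N = 2^n], [s = |supp f^|], let [c_S] be the sum of the
    character [S] over [A], and let [B = N I(f)] be the number of sensitive
    pairs [(x, i)].
    - Fourth moment: [sum_S c_S^2 = N a] and [sum_S c_S^4 = N E(A)], so
      Cauchy-Schwarz on the support gives [N a^2 <= s E(A)].
    - Poincare: [N B = 4 sum_S |S| c_S^2 >= 4 (N a - a^2)].
    - Uncertainty: at a zero of [f], Fourier inversion gives
      [a = c_0 <= sum_(S != 0) |c_S| <= (s - 1) (N - a)], so [N <= s (N - a)].
    The last two give [4 a <= s B], and the first gives
    [a^3 / E(A) <= s a / N]; hence [4 a^3 / E(A) <= s^2 I(f)], which is
    stronger than the claim. *)
Require Import Defs.
From HB Require Import structures.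
From mathcomp Require Import all_boot all_order all_algebra.
From mathcomp Require Import ring lra.

Set Implicit Arguments.
Unset Strict Implicit.
Unset Printing Implicit Defensive.

Import Order.TTheory GRing.Theory Num.Theory.
Local Open Scope ring_scope.

(** Cauchy-Schwarz against the constant 1: the variance-like sum of [(s * F i - P) ^+ 2] equals
    [s * (s * Q - P ^+ 2)], and [s > 0] cancels. *)
Lemma sqr_sum_le_card (R : realFieldType) (I : finType) (A : {set I})
    (F : I -> R) :
  (\sum_(i in A) F i) ^+ 2 <= #|A|%:R * \sum_(i in A) F i ^+ 2.
Proof.
have [->|A_neq0] := eqVneq A set0; first by rewrite !big_set0 expr0n mulr0.
have s_gt0 : 0 < #|A|%:R :> R by rewrite ltr0n card_gt0.
set s := #|A|%:R in s_gt0 *; set P := \sum_(i in A) F i.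
set Q := \sum_(i in A) F i ^+ 2.
have : 0 <= \sum_(i in A) (s * F i - P) ^+ 2.
  by apply: sumr_ge0 => i _; exact: sqr_ge0.
have -> : \sum_(i in A) (s * F i - P) ^+ 2 = s * (s * Q - P ^+ 2).
  transitivity (\sum_(i in A)
      (s ^+ 2 * F i ^+ 2 + (- (2 * s * P)) * F i + P ^+ 2)).
    by apply: eq_bigr => i _; ring.
  rewrite !big_split /= -!mulr_sumr sumr_const -mulr_natl -/P -/Q -/s.
  ring.
by rewrite pmulr_rge0 // subr_ge0.
Qed.

Lemma F2_oppr (x : 'F_2) : - x = x.
Proof. by apply: oppr_pchar2; rewrite pchar_Fp. Qed.

Lemma cube_oppr (n : nat) (x : cube n) : - x = x.
Proof. by apply/rowP => i; rewrite mxE F2_oppr. Qed.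

Lemma card_cube (n : nat) : #|{: cube n}| = (2 ^ n)%N.
Proof. by rewrite card_mx card_Fp // mul1n. Qed.

(** * Characters of the cube and unnormalised Fourier analysis *)

Section Characters.
Variables (R : realFieldType) (n : nat).
Implicit Types (S : {set 'I_n}) (x y : cube n) (g : cube n -> R).

Definition sign2 (a : 'F_2) : R := (-1) ^+ nat_of_ord a.

Lemma sign2D : {morph sign2 : a b / a + b >-> a * b}.
Proof.
move=> a b; rewrite /sign2 /= -exprD -[LHS]signr_odd -[RHS]signr_odd.
by rewrite modn2 oddb.
Qed.

Definition chi S x : R := sign2 (dot2 (indicator_vec S) x).

Lemma chi_prod S x : chi S x = \prod_i (if i \in S then sign2 (x 0 i) else 1).
Proof.
rewrite /chi /dot2 (big_morph sign2 sign2D (erefl : sign2 0 = 1)).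
by apply: eq_bigr => i _; rewrite mxE; case: ifP; rewrite ?mul1r ?mul0r.
Qed.

Lemma chiD S x y : chi S (x + y) = chi S x * chi S y.
Proof.
rewrite /chi -sign2D /dot2 -big_split /=; congr sign2.
by apply: eq_bigr => i _; rewrite [(x + y) 0 i]mxE mulrDr.
Qed.

Lemma chi_set0 x : chi set0 x = 1.
Proof. by rewrite chi_prod big1 // => i _; rewrite inE. Qed.

Lemma normr_chi S x : `|chi S x| = 1.
Proof. by rewrite /chi /sign2 normrX normrN1 expr1n. Qed.

Lemma chi_basis S i : chi S (basis_vec i) = if i \in S then -1 else 1.
Proof.
rewrite chi_prod (bigD1 i) //= big1 => [|j ji].
  by rewrite mxE !eqxx mulr1.
by rewrite mxE (negbTE ji) andbF; case: ifP.
Qed.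

(** By distributivity the sum over subsets factors over coordinates, and any coordinate of [x] equal
    to 1 contributes the factor -1 + 1 = 0. *)
Lemma sum_chi_dual x : \sum_S chi S x = (2 ^+ n) * (x == 0)%:R.
Proof.
transitivity (\prod_i (sign2 (x 0 i) + 1)).
  by rewrite bigA_distr; apply: eq_bigr => S _; exact: chi_prod.
have [->|x_neq0] := eqVneq x 0.
  rewrite mulr1 (eq_bigr (fun=> 2)) => [|i _].
    by rewrite prodr_const card_ord.
  by rewrite mxE /sign2 /= expr0.
have /rV0Pn[i xi_neq0] := x_neq0.
rewrite mulr0 (bigD1 i) //=.
case: (x 0 i) xi_neq0 => [[|[|//]]] //= lt_i _.
by rewrite /sign2 /= expr1 addNr mul0r.
Qed.

(** Translating by [basis_vec i] with [i \in S] flips the sign of the sum. *)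
Lemma sum_chi S : S != set0 -> \sum_x chi S x = 0.
Proof.
case/set0Pn => i Si; set t := \sum_x _.
have : t = - t.
  rewrite {1}/t (reindex_inj (addIr (basis_vec i))) /= -sumrN.
  by apply: eq_bigr => x _; rewrite chiD chi_basis Si mulrN1.
lra.
Qed.

(** This is [2 ^+ n] times the Fourier coefficient; dropping the normalisation avoids divisions and
    keeps the support. *)
Definition char_sum g S : R := \sum_x g x * chi S x.

Lemma fourier_neq0 g S : (fourier g S != 0) = (char_sum g S != 0).
Proof. by rewrite mulf_eq0 invr_eq0 expf_eq0 pnatr_eq0 andbF. Qed.

Lemma char_sum_eq0 g S : S \notin fourier_support g -> char_sum g S = 0.
Proof. by rewrite inE fourier_neq0 negbK => /eqP. Qed.

Lemma char_sum_inversion g x :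
  \sum_S char_sum g S * chi S x = 2 ^+ n * g x.
Proof.
transitivity (\sum_y g y * \sum_S chi S (y + x)).
  under eq_bigr do rewrite mulr_suml.
  rewrite exchange_big; apply: eq_bigr => y _ /=.
  by rewrite mulr_sumr; apply: eq_bigr => S _; rewrite chiD mulrA.
under eq_bigr do rewrite sum_chi_dual -[x in _ + x]cube_oppr subr_eq0.
rewrite (bigD1 x) //= big1 => [|y /negbTE ->]; last by rewrite !mulr0.
by rewrite eqxx mulr1 addr0 mulrC.
Qed.

Lemma parseval g : \sum_S char_sum g S ^+ 2 = 2 ^+ n * \sum_x g x ^+ 2.
Proof.
transitivity (\sum_x g x * \sum_S char_sum g S * chi S x).
  under [RHS]eq_bigr do rewrite mulr_sumr.
  rewrite exchange_big; apply: eq_bigr => S _ /=.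
  (* Only one of the two factors is expanded; the other is left for the inversion formula. *)
  rewrite expr2 {2}/char_sum mulr_sumr.
  by apply: eq_bigr => x _; ring.
rewrite mulr_sumr; apply: eq_bigr => x _.
by rewrite char_sum_inversion; ring.
Qed.

(** Translation by [basis_vec i] multiplies the coefficient by [chi S (basis_vec i)], which is -1 or
    1. *)
Lemma char_sum_derivative g i S :
  char_sum (fun x => g x - g (x + basis_vec i)) S
    = (if i \in S then 2 else 0) * char_sum g S.
Proof.
have shift : \sum_x g (x + basis_vec i) * chi S x
    = chi S (basis_vec i) * char_sum g S.
  rewrite (reindex_inj (addIr (basis_vec i))) /= mulr_sumr.
  apply: eq_bigr => x _.
  rewrite -addrA -{2}[basis_vec i]cube_oppr subrr addr0 chiD; ring.
transitivity ((1 - chi S (basis_vec i)) * char_sum g S).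
  rewrite mulrBl mul1r -shift -sumrB.
  by apply: eq_bigr => x _; rewrite mulrBl.
by rewrite chi_basis; case: ifP => _; congr (_ * _); ring.
Qed.

End Characters.

(** * Energy, influence and support size of a Boolean function *)

Section BooleanFunction.
Variables (R : realFieldType) (n : nat) (f : cube n -> bool).
Let F (x : cube n) : R := (f x)%:R.
Let A := bool_support f.
Let supp := fourier_support F.
Let N : R := 2 ^+ n.
Local Notation c := (char_sum F).

Let N_gt0 : 0 < N. Proof. exact: exprn_gt0. Qed.

Lemma sum_bool_support : \sum_x F x = #|A|%:R.
Proof.
rewrite -sum1_card natr_sum [RHS]big_mkcond /=; apply: eq_bigr => x _.
by rewrite inE /F; case: (f x).
Qed.

Lemma char_sum_set0 : c set0 = #|A|%:R.
Proof.
rewrite -sum_bool_support; apply: eq_bigr => x _.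
by rewrite chi_set0 mulr1.
Qed.

Lemma parseval_bool : \sum_S c S ^+ 2 = N * #|A|%:R.
Proof.
rewrite parseval -sum_bool_support; congr (_ * _).
by apply: eq_bigr => x _; rewrite /F; case: (f x); rewrite ?expr1n ?expr0n.
Qed.

(** Expanding the power gives quadruples in [A]; summing over [S] keeps those with zero sum, which
    in characteristic 2 are the additive quadruples. *)
Lemma char_sum_exp4 : \sum_S c S ^+ 4 = N * (additive_energy A)%:R.
Proof.
transitivity (\sum_(p : cube n * cube n * cube n * cube n)
    F p.1.1.1 * F p.1.1.2 * F p.1.2 * F p.2 *
    \sum_S chi R S (p.1.1.1 + p.1.1.2 + p.1.2 + p.2)).
  under [RHS]eq_bigr do rewrite mulr_sumr.
  rewrite exchange_big; apply: eq_bigr => S _ /=.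
  rewrite !exprSr expr0 mul1r /char_sum.
  rewrite big_distrlr /= pair_big /=.
  rewrite big_distrlr /= pair_big /= big_distrlr /= pair_big /=.
  by apply: eq_bigr => p _; rewrite !chiD; ring.
rewrite /additive_energy -sum1_card natr_sum [in RHS]big_mkcond mulr_sumr.
apply: eq_bigr => -[[[x y] z] t] _ /=.
rewrite sum_chi_dual -/N !inE -addrA -[z + t]cube_oppr subr_eq0 cube_oppr /F.
case: (f x); case: (f y); case: (f z); case: (f t); case: eqP => _ /=;
  by rewrite ?(mulr0, mul0r, mulr1, mul1r).
Qed.

Lemma energy_ge :
  N * #|A|%:R ^+ 2 <= #|supp|%:R * (additive_energy A)%:R :> R.
Proof.
(* The exponent is a successor because [0 ^+ 0 = 1] would count sets off the support. *)
have supp_sum (k : nat) : \sum_S c S ^+ k.+1 = \sum_(S in supp) c S ^+ k.+1.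
  rewrite [RHS]big_mkcond /=; apply: eq_bigr => S _.
  by case: ifPn => // /char_sum_eq0 ->; rewrite expr0n.
have := sqr_sum_le_card supp (fun S => c S ^+ 2).
under [X in _ * X]eq_bigr do rewrite -exprM.
rewrite -!supp_sum parseval_bool char_sum_exp4 => le_sq.
by rewrite -(ler_pM2l N_gt0); lra.
Qed.

(** Parseval is applied to each discrete derivative, whose square is the indicator of sensitivity in
    direction [i]. The factor 4 is the square of the 2 in [char_sum_derivative], and summing over
    [i] counts [#|S|]. *)
Lemma total_influence_sum :
  N * (N * total_influence R f) = 4 * \sum_(S : {set 'I_n}) #|S|%:R * c S ^+ 2.
Proof.
transitivity (\sum_(i < n) \sum_(S : {set 'I_n})
    (if i \in S then 4 else 0) * c S ^+ 2); last first.
  rewrite exchange_big mulr_sumr; apply: eq_bigr => S _ /=.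
  rewrite -mulr_suml -big_mkcond sumr_const -mulr_natl; ring.
rewrite /total_influence mulr_sumr mulr_sumr; apply: eq_bigr => i _.
transitivity (\sum_S
    char_sum (fun x => F x - F (x + basis_vec i)) S ^+ 2); last first.
  apply: eq_bigr => S _; rewrite char_sum_derivative.
  by case: ifP => _; ring.
rewrite parseval /influence card_cube natrX -/N.
rewrite [N * (_ / _)]mulrC divfK ?gt_eqF //.
congr (_ * _); rewrite -sum1_card natr_sum big_mkcond; apply: eq_bigr => x _.
rewrite inE /F; case: (f x); case: (f _) => /=; ring.
Qed.

Lemma poincare :
  4 * #|A|%:R * (N - #|A|%:R) <= N * (N * total_influence R f).
Proof.
have -> : 4 * #|A|%:R * (N - #|A|%:R) = 4 * \sum_(S | S != set0) c S ^+ 2.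
  have := parseval_bool; rewrite (bigD1 set0) //= char_sum_set0; lra.
rewrite total_influence_sum ler_pM2l // [in leRHS](bigD1 set0) //=.
rewrite cards0 mul0r add0r; apply: ler_sum => S S_neq0.
by rewrite ler_peMl ?sqr_ge0 // ler1n card_gt0.
Qed.

(** A nontrivial character sums to 0, so [F] may be replaced by [F - 1], supported on the complement
    of [A]. *)
Lemma normr_char_sum_le S : S != set0 -> `|c S| <= N - #|A|%:R.
Proof.
move=> S_neq0.
have -> : c S = - \sum_x (1 - F x) * chi R S x.
  under [in RHS]eq_bigr do rewrite mulrBl mul1r.
  by rewrite sumrB sum_chi // sub0r opprK.
rewrite normrN (le_trans (ler_norm_sum _ _ _)) //.
have -> : N - #|A|%:R = \sum_x (1 - F x).
  by rewrite sumrB sum_bool_support sumr_const card_cube natrX.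
apply: ler_sum => x _; rewrite normrM normr_chi mulr1 ger0_norm //.
by rewrite subr_ge0 /F lern1 leq_b1.
Qed.

Lemma uncertainty x0 x1 : ~~ f x0 -> f x1 -> N <= #|supp|%:R * (N - #|A|%:R).
Proof.
move=> fx0 fx1.
have A_gt0 : 0 < #|A|%:R :> R.
  by rewrite ltr0n card_gt0; apply/set0Pn; exists x1; rewrite inE.
have supp0 : set0 \in supp.
  by rewrite inE fourier_neq0 char_sum_set0 gt_eqF.
have := char_sum_inversion F x0.
rewrite {2}/F (negbTE fx0) mulr0 (bigD1 set0) //= char_sum_set0 chi_set0 mulr1.
move/eqP; rewrite addr_eq0 => /eqP A_eq.
have A_le : #|A|%:R <= #|supp :\ set0|%:R * (N - #|A|%:R).
  rewrite mulr_natl -[leRHS]sumr_const.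
  rewrite -{1}(gtr0_norm A_gt0) {1}A_eq normrN.
  rewrite (le_trans (ler_norm_sum _ _ _)) //.
  rewrite big_mkcond [leRHS]big_mkcond; apply: ler_sum => S _.
  rewrite in_setD1; case: ifP => //= S_neq0.
  rewrite normrM normr_chi mulr1; case: ifPn => [_|/char_sum_eq0 ->].
    exact: normr_char_sum_le.
  by rewrite normr0.
(* Adding [N - #|A|] to both sides of [A_le] restores the term of [set0]. *)
have -> : #|supp| = #|supp :\ set0|.+1 by rewrite (cardsD1 set0) supp0.
by rewrite -natr1; lra.
Qed.

End BooleanFunction.

Theorem theorem2 (R : realFieldType) (n : nat) (f : cube n -> bool)
    (f_nonconst : exists x y : cube n, f x <> f y) :
  3 * #|bool_support f|%:R ^+ 3
    / (128 * (additive_energy (bool_support f))%:R)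
  < total_influence R f
    * #|fourier_support (fun x : cube n => (f x)%:R : R)|%:R ^+ 2.
Proof.
have [x0 [x1 [fx0 fx1]]] : exists x0 x1, ~~ f x0 /\ f x1.
  case: f_nonconst => x [y]; case fx : (f x); case fy : (f y) => // _.
    by exists y, x; rewrite fx fy.
  by exists x, y; rewrite fx fy.
have A_gt0 : 0 < #|bool_support f|%:R :> R.
  by rewrite ltr0n card_gt0; apply/set0Pn; exists x1; rewrite inE.
have := energy_ge R f; have := poincare R f; have := uncertainty R fx0 fx1.
have : 0 < 2 ^+ n :> R by exact: exprn_gt0.
move: (2 ^+ n) (additive_energy _)%:R (total_influence _ _) => N E I.
move: #|bool_support f|%:R A_gt0 => a a_gt0.
set s : R := #|_|%:R; have s_ge0 : 0 <= s by exact: ler0n.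
move=> N_gt0 uncert poinc energy.
(* With [s = 0], [uncert] would read [N <= 0]. *)
have s_gt0 : 0 < s.
  rewrite lt_neqAle s_ge0 andbT eq_sym; apply/eqP => s0.
  by rewrite s0 in uncert; lra.
have E_gt0 : 0 < E.
  rewrite -(pmulr_rgt0 _ s_gt0); apply: lt_le_trans energy.
  by rewrite mulr_gt0 ?exprn_gt0.
(* After scaling by [N], the chain is [4 a N <= 4 a s (N - a) <= s N (N I)], by [uncert] and then
   [poinc]. *)
have sB : 4 * a <= s * (N * I).
  rewrite -(ler_pM2l N_gt0).
  have := ler_wpM2l s_ge0 poinc.
  have := ler_wpM2l (ltW a_gt0) uncert.
  lra.
rewrite ltr_pdivrMr ?mulr_gt0 //.
have a3_gt0 : 0 < a ^+ 3 by exact: exprn_gt0.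
have le1 : 4 * a ^+ 3 * N <= s * E * (4 * a).
  have := ler_wpM2l (ltW a_gt0) energy; lra.
have le2 : s * E * (4 * a) <= s * E * (s * (N * I)).
  by rewrite ler_pM2l ?mulr_gt0.
have le3 : 4 * a ^+ 3 <= I * s ^+ 2 * E.
  rewrite -(ler_pM2l N_gt0); lra.
(* By [le3], [128 I s^2 E >= 512 a^3], which exceeds [3 a^3] strictly because [a > 0]. *)
lra.
Qed.
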